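(* Let $S = \langle a_1, \ldots, a_k\rangle$ be a numerical semigroup with minimal generators $a_1 < \cdots < a_k$, $k \ge 2$, and let $A = a_1 + \cdots + a_k$. Fix real numbers $B, B' > 0$. For all sufficiently large $x \in S$, we have $$\mathcal L_\infty(x + a_i, i) \cap [\tfrac{1}{a_i}(x + a_i) - B, \infty) = 1 + \big( \mathcal L_\infty(x,i) \cap [\tfrac{1}{a_i}x - B, \infty) \big)$$ for each $i \in \{1,\ldots,k\}$, as well as $$\mathcal L_\infty(x + A) \cap [0, \tfrac{1}{A}(x + A) + B'] = 1 + \big( \mathcal L_\infty(x) \cap [0, \tfrac{1}{A}x + B'] \big).$$ In particular, the first equality (for a given $i$) holds whenever $x > a_i^2 C_j + a_i B$ for every $j \ne i$, where $C_j = \lceil \tfrac{1}{a_j}(B + 1) \rceil$, and the second equality holds whenever $x > \tfrac{1}{a_i}A(A - a_i)B'$ for every $i \in \{1,\ldots,k\}$.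
   Context: A numerical semigroup is a cofinite, additively closed subset $S \subseteq \mathbb{Z}_{\ge 0}$ containing $0$. For $x \in S$, $\mathsf Z(x) = \{z \in \mathbb{Z}_{\ge 0}^k : x = z_1a_1 + \cdots + z_ka_k\}$; for $z \in \mathsf Z(x)$, $\ell_\infty(z) = \max(z_1,\ldots,z_k)$; $\mathcal L_\infty(x) = \{\ell_\infty(z) : z \in \mathsf Z(x)\}$; $\mathsf Z(x,i) = \{z \in \mathsf Z(x) : z_i = \ell_\infty(z)\}$; and $\mathcal L_\infty(x,i) = \{\ell_\infty(z) : z \in \mathsf Z(x,i)\}$. For a set $X$ of integers, $1 + X = \{1 + n : n \in X\}$. *)

(* Defs.v *)
From HB Require Import structures.
From mathcomp Require Import all_boot all_order all_algebra.
From mathcomp Require Import all_classical all_reals.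

Set Implicit Arguments.
Unset Strict Implicit.
Unset Printing Implicit Defensive.

Import Order.TTheory GRing.Theory Num.Theory.

Local Open Scope classical_set_scope.
Local Open Scope ring_scope.

Definition numerical_semigroup (S : set nat) : Prop :=
  [/\ S 0%N, (forall x y, S x -> S y -> S (x + y)%N) & finite_set (~` S)].

Section Factorizations.

Variables (k : nat) (a : 'I_k -> nat).

Definition generated (J : {set 'I_k}) : set nat :=
  [set x | exists z : {ffun 'I_k -> nat}, x = (\sum_(i in J) z i * a i)%N].

Definition minimally_generates (S : set nat) : Prop :=
  S = generated [set: 'I_k] /\
  forall J : {set 'I_k}, J \proper [set: 'I_k] -> S <> generated J.

Definition factorizations (x : nat) : set {ffun 'I_k -> nat} :=
  [set z | x = (\sum_(i < k) z i * a i)%N].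

Definition linf (z : {ffun 'I_k -> nat}) : nat := (\max_(i < k) z i)%N.

Definition Linf (x : nat) : set nat := linf @` factorizations x.

Definition factorizations_at (x : nat) (i : 'I_k) : set {ffun 'I_k -> nat} :=
  [set z | factorizations x z /\ z i = linf z].

Definition Linf_at (x : nat) (i : 'I_k) : set nat :=
  linf @` factorizations_at x i.

End Factorizations.

Definition one_plus (X : set nat) : set nat := [set (1 + n)%N | n in X].

Definition cap_itv (R : realType) (X : set nat) (I : interval R) : set nat :=
  X `&` [set n : nat | n%:R \in I].

(* Main.v *)
Require Import Defs.
From HB Require Import structures.
From mathcomp Require Import all_boot all_order all_algebra.
From mathcomp Require Import all_classical all_reals.
From mathcomp Require Import lra.

Import Order.TTheory GRing.Theory Num.Theory.

Local Open Scope ring_scope.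

(** Adding one copy of [a i] to a factorization of [x] in which the [i]-th
    coordinate is maximal, or one copy of every generator to an arbitrary
    factorization, raises the max norm by exactly one and moves the cut-off of
    the length interval by exactly one.  Hence the right-hand side of either
    equality always embeds in the left-hand side, and equality holds as soon
    as the translation can be undone on every factorization whose norm lies in
    the interval ([cap_Linf_at_shift], [cap_Linf_shift]).

    Undoing it is possible because of a size estimate.  If [z i] is within [B]
    of [(x + a i) / a i], the other generators share a weight of at most
    [a i * B], so their multiplicities are bounded independently of [x] while
    [z i] grows with [x]: for large [x] the maximum at [i] is strict and one
    copy of [a i] can be removed ([dominant_coordinate_lt]).  If on the contrary
    the norm of [z] is at most [(x + A) / A + B'], about the least value possible,
    then no coordinate can vanish: the other generators, each used at most
    that often, would weigh too little ([balanced_coordinate_gt0]).  So one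
    copy of each generator can be removed. *)

Section Translation.

Context {k : nat} (a : 'I_k -> nat).
Implicit Types (z u : {ffun 'I_k -> nat}) (i j : 'I_k).

Lemma leq_linf z i : (z i <= linf z)%N.
Proof. exact: leq_bigmax. Qed.

Lemma linf_eqP z i : z i = linf z <-> forall j, (z j <= z i)%N.
Proof.
split=> [-> j|h]; first exact: leq_linf.
by apply/eqP; rewrite eqn_leq leq_linf /=; apply/bigmax_leqP.
Qed.

(** With no coordinates at all the maximum would stay 0, whence the witness. *)
Lemma linf_succ z (i0 : 'I_k) : linf [ffun j => (z j).+1] = (linf z).+1.
Proof.
apply/eqP; rewrite eqn_leq; apply/andP; split.
  by apply/bigmax_leqP => j _; rewrite ffunE ltnS leq_linf.
rewrite {1}/linf (bigop.bigmax_eq_arg i0) //.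
case: arg_maxnP => //= j _ _.
by have := leq_linf [ffun j => (z j).+1] j; rewrite ffunE.
Qed.

Lemma sum_incr_at z i :
  (\sum_(j < k) (z j + (j == i)) * a j = \sum_(j < k) z j * a j + a i)%N.
Proof.
rewrite (eq_bigr (fun j => z j * a j + (j == i) * a j)%N); last first.
  by move=> j _; rewrite mulnDl.
rewrite big_split /=; congr addn.
rewrite (bigD1 i) //= eqxx mul1n big1 ?addn0 // => j /negbTE ->.
by rewrite mul0n.
Qed.

Lemma sum_incr z :
  (\sum_(j < k) (z j).+1 * a j = \sum_(j < k) z j * a j + \sum_(j < k) a j)%N.
Proof. by rewrite -big_split /=; apply: eq_bigr => j _; rewrite mulSn addnC. Qed.

(** The hypothesis on [z] is exactly what makes [z] minus one copy of [a i] a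
    factorization with its maximum still at [i]. *)
Lemma cap_Linf_at_shift (R : realType) (I J : interval R) (x : nat) i :
    (forall n : nat, (n.+1%:R \in J) = (n%:R \in I)) ->
    (forall z, factorizations_at a (x + a i)%N i z -> (z i)%:R \in J ->
       (0 < z i)%N /\ forall j, j != i -> (z j < z i)%N) ->
  cap_itv (Linf_at a (x + a i)%N i) J = one_plus (cap_itv (Linf_at a x i) I).
Proof.
move=> IJ hz; apply/seteqP; split=> n /=.
- case=> -[z [zf zi] <-] nJ; rewrite -zi in nJ.
  have [zi0 zlt] := hz z (conj zf zi) nJ.
  pose w : {ffun 'I_k -> nat} := [ffun j => (z j - (j == i))%N].
  have wE : forall j, z j = (w j + (j == i))%N.
    by move=> j; rewrite ffunE subnK //; case: eqP => // ->.
  have wi : w i = linf w.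
    apply/linf_eqP => j; have [->//|ji] := eqVneq j i.
    by have := zlt j ji; rewrite !wE eqxx (negbTE ji) addn0 addn1 ltnS.
  have nE : linf z = (w i).+1 by rewrite -zi wE eqxx addn1.
  exists (w i); last by rewrite nE.
  split; last by rewrite /= -IJ -nE -zi.
  exists w => //; split=> //; rewrite /factorizations /=.
  move: zf; rewrite /factorizations /= => zf.
  apply: (@addIn (a i)); rewrite zf -sum_incr_at.
  by apply: eq_bigr => j _; rewrite -wE.
- case=> _ [[z [zf zi] <-] nI] <-.
  pose w : {ffun 'I_k -> nat} := [ffun j => (z j + (j == i))%N].
  have wi : w i = linf w.
    apply/linf_eqP => j; rewrite !ffunE eqxx.
    by apply: leq_add; [rewrite zi leq_linf|case: eqP].
  split; last by rewrite /= add1n IJ.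
  exists w; last by rewrite -wi ffunE eqxx zi addnC.
  split=> //; rewrite /factorizations /=.
  by rewrite zf -sum_incr_at; apply: eq_bigr => j _; rewrite ffunE.
Qed.

Lemma cap_Linf_shift (R : realType) (I J : interval R) (x : nat) (i0 : 'I_k) :
    (forall n : nat, (n.+1%:R \in J) = (n%:R \in I)) ->
    (forall z, factorizations a (x + \sum_(j < k) a j)%N z ->
       (linf z)%:R \in J -> forall j, (0 < z j)%N) ->
  cap_itv (Linf a (x + \sum_(j < k) a j)%N) J = one_plus (cap_itv (Linf a x) I).
Proof.
move=> IJ hz; apply/seteqP; split=> n /=.
- case=> -[z zf <-] nJ; have z0 := hz z zf nJ.
  pose w : {ffun 'I_k -> nat} := [ffun j => (z j).-1].
  have zE : z = [ffun j => (w j).+1] by apply/ffunP => j; rewrite !ffunE prednK.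
  have nE : linf z = (linf w).+1 by rewrite zE linf_succ.
  exists (linf w); last by rewrite nE.
  split; last by rewrite /= -IJ -nE.
  exists w => //; rewrite /factorizations /=.
  move: zf; rewrite /factorizations /= => zf.
  apply: (@addIn (\sum_(j < k) a j)); rewrite zf -sum_incr.
  by apply: eq_bigr => j _; rewrite zE ffunE.
- case=> _ [[z zf <-] nI] <-.
  split; last by rewrite /= add1n IJ.
  exists [ffun j => (z j).+1]; last by rewrite linf_succ.
  rewrite /factorizations /=.
  by rewrite zf -sum_incr; apply: eq_bigr => j _; rewrite ffunE.
Qed.

(** A generator equal to 0 could be dropped. *)
Lemma minimal_generator_gt0 (S : set nat) :
  minimally_generates a S -> forall i, (0 < a i)%N.
Proof.
move=> [SE Smin] i; rewrite lt0n; apply/eqP => ai0.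
apply: (Smin (finset.setC [set i])).
  apply/fintype.properP; split.
    by apply/fintype.subsetP => j _; exact: mem_set.
  by exists i; [exact: mem_set|rewrite !inE eqxx].
rewrite SE; apply/seteqP; split=> _ [z ->]; exists z.
- rewrite [LHS](bigD1 i) ?finset.in_setT //= ai0 muln0 add0n.
  by apply: eq_bigl => j; rewrite !inE.
- rewrite [RHS](bigD1 i) ?finset.in_setT //= ai0 muln0 add0n.
  by apply: eq_bigl => j; rewrite !inE.
Qed.

Section Estimates.

Context {R : realType}.
Hypothesis a_gt0 : forall i, (0 < a i)%N.

(** The weight left for [a j] besides [z i] copies of [a i] is at most
    [a i * B], while [z i - 1] exceeds [x / a i - B], which the assumption on [x]
    makes larger than [a i * B / a j]. *)
Lemma dominant_coordinate_lt (B : R) (x : nat) z i j :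
    j != i -> factorizations a (x + a i)%N z ->
    (a i)%:R^-1 * (x + a i)%:R - B <= (z i)%:R ->
    (a i)%:R * (a i)%:R * ((a j)%:R^-1 * B) + (a i)%:R * B < x%:R ->
  (z j < z i)%N.
Proof.
move=> ji zf zi hx.
have ai0 : 0 < (a i)%:R :> R by rewrite ltr0n.
have aj0 : 0 < (a j)%:R :> R by rewrite ltr0n.
have wt : (z i * a i + z j * a j <= x + a i)%N.
  by rewrite zf (bigD1 i) //= leq_add2l (bigD1 j) //= leq_addr.
move: wt; rewrite -(ler_nat R) !natrD !natrM => wt.
have {}zi : x%:R + (a i)%:R <= ((z i)%:R + B) * (a i)%:R :> R.
  by rewrite -ler_pdivrMr // mulrC -natrD -lerBlDr.
have zj : (z j)%:R <= (a i)%:R * ((a j)%:R^-1 * B) :> R.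
  by rewrite mulrCA mulrC ler_pdivlMr //; nra.
rewrite -(ltr_nat R) -(ltr_pM2r ai0).
have := ler_wpM2r (ltW ai0) zj; nra.
Qed.

(** If [z i = 0], then [x + A] is at most [A - a i] times the norm of [z];
    inserting the bound on the norm and solving for [x] contradicts the lower
    bound on [x]. *)
Lemma balanced_coordinate_gt0 (B' : R) (x : nat) z i
    (A := (\sum_(j < k) a j)%N) :
    factorizations a (x + A)%N z ->
    (linf z)%:R <= A%:R^-1 * (x + A)%:R + B' ->
    (a i)%:R^-1 * A%:R * (A%:R - (a i)%:R) * B' < x%:R ->
  (0 < z i)%N.
Proof.
move=> zf zle hx; rewrite lt0n; apply/eqP => zi0.
have ai0 : 0 < (a i)%:R :> R by rewrite ltr0n.
pose D := (\sum_(j < k | j != i) a j)%N.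
have AE : A = (a i + D)%N by rewrite /A (bigD1 i).
have wt : (x + A <= linf z * D)%N.
  rewrite zf (bigD1 i) //= zi0 mul0n add0n /D big_distrr /=.
  by apply: leq_sum => j _; rewrite leq_mul2r leq_linf orbT.
have A0 : 0 < A%:R :> R by rewrite ltr0n AE addn_gt0 a_gt0.
have DE : A%:R - (a i)%:R = D%:R :> R by rewrite AE natrD addrC addKr.
have D0 : 0 <= D%:R :> R by [].
move: wt; rewrite -(ler_nat R) natrM => wt.
have {}wt := le_trans wt (ler_wpM2r D0 zle).
move: hx; rewrite DE -!mulrA ltr_pdivrMl // => hx.
have {}wt : (x + A)%:R * A%:R <= ((x + A)%:R + A%:R * B') * D%:R :> R.
  rewrite [leLHS]mulrC (le_trans (ler_wpM2l (ltW A0) wt)) //.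
  by rewrite mulrA mulrDr mulVKf // gt_eqF.
have AR : A%:R = (a i)%:R + D%:R :> R by rewrite AE natrD.
have : (a i)%:R * A%:R > 0 :> R by rewrite mulr_gt0.
by move: wt hx; rewrite natrD -DE; nra.
Qed.

End Estimates.

End Translation.

Lemma eventually_gt_fin (R : realType) (T : finType) (f : T -> R) :
  exists N : nat, forall n : nat, (N <= n)%N -> forall t, f t < n%:R.
Proof.
exists (\max_t Num.bound `|f t|)%N => n Nn t.
apply: le_lt_trans (ler_norm _) _.
apply: lt_le_trans (archi_boundP (normr_ge0 _)) _.
by rewrite ler_nat (leq_trans _ Nn) // leq_bigmax.
Qed.

Theorem theorem2p4 (R : realType) (k : nat) (a : 'I_k -> nat) (S : set nat)
    (hS : numerical_semigroup S)
    (hmin : minimally_generates a S)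
    (hlt : forall i j : 'I_k, (i < j)%N -> (a i < a j)%N)
    (hk : (2 <= k)%N)
    (A : nat) (hA : A = (\sum_(i < k) a i)%N)
    (B B' : R) (hB : 0 < B) (hB' : 0 < B') :
  let eq_at (x : nat) (i : 'I_k) : Prop :=
    cap_itv (Linf_at a (x + a i)%N i)
      `[(a i)%:R^-1 * (x + a i)%:R - B, +oo[
    = one_plus (cap_itv (Linf_at a x i) `[(a i)%:R^-1 * x%:R - B, +oo[) in
  let eq_all (x : nat) : Prop :=
    cap_itv (Linf a (x + A)%N) `[0, A%:R^-1 * (x + A)%:R + B']
    = one_plus (cap_itv (Linf a x) `[0, A%:R^-1 * x%:R + B']) in
  let C (j : 'I_k) : int := Num.ceil ((a j)%:R^-1 * (B + 1)) in
  [/\ exists N : nat, forall x : nat, S x -> (N <= x)%N ->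
        (forall i : 'I_k, eq_at x i) /\ eq_all x,
      forall (i : 'I_k) (x : nat), S x ->
        (forall j : 'I_k, j != i ->
           (a i)%:R ^+ 2 * (C j)%:~R + (a i)%:R * B < x%:R) ->
        eq_at x i
    & forall x : nat, S x ->
        (forall i : 'I_k,
           (a i)%:R^-1 * A%:R * (A%:R - (a i)%:R) * B' < x%:R) ->
        eq_all x].

Proof.
move=> eq_at eq_all C.
have a_gt0 := minimal_generator_gt0 _ _ hmin.
have eq_atP (i : 'I_k) (x : nat) :
    (forall j : 'I_k, j != i ->
       (a i)%:R ^+ 2 * (C j)%:~R + (a i)%:R * B < x%:R) -> eq_at x i.
  move=> hx; have ai0 : 0 < (a i)%:R :> R by rewrite ltr0n.
  have divE : (a i)%:R^-1 * (x + a i)%:R = (a i)%:R^-1 * x%:R + 1 :> R.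
    by rewrite natrD mulrDr mulVf // gt_eqF.
  apply: cap_Linf_at_shift => [n|z [zf _]].
    by rewrite !in_itv /= !andbT divE -natr1 addrAC lerD2r.
  rewrite in_itv /= andbT => zi.
  have zlt j : j != i -> (z j < z i)%N.
    move=> ji; apply: (dominant_coordinate_lt a a_gt0 B x) => //.
    apply: le_lt_trans (hx j ji); rewrite lerD2r expr2 ler_wpM2l ?mulr_ge0 //.
    apply: le_trans (Num.Theory.ceil_ge _).
    by rewrite ler_wpM2l ?invr_ge0 // lerDl.
  split=> //.
  (* As [k >= 2], some other coordinate lies strictly below [z i]. *)
  have [j ji] : exists j, j != i.
    have : (1 < #|'I_k|)%N by rewrite card_ord.
    by case/card_gt1P => u [v [_ _ uv]]; have [<-|] := eqVneq u i;
       [exists v; rewrite eq_sym|exists u].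
  exact: leq_ltn_trans (leq0n _) (zlt j ji).
have eq_allP (x : nat) :
    (forall i : 'I_k,
       (a i)%:R^-1 * A%:R * (A%:R - (a i)%:R) * B' < x%:R) -> eq_all x.
  rewrite /eq_all; move: hA => -> hx; pose i0 : 'I_k := Ordinal (ltnW hk).
  have A0 : 0 < (\sum_(i < k) a i)%N%:R :> R.
    by rewrite ltr0n (bigD1 i0) //= addn_gt0 a_gt0.
  have divE : (\sum_(i < k) a i)%N%:R^-1 * (x + \sum_(i < k) a i)%:R
      = (\sum_(i < k) a i)%N%:R^-1 * x%:R + 1 :> R.
    by rewrite natrD mulrDr mulVf // gt_eqF.
  apply: (cap_Linf_shift a _ _ _ _ i0) => [n|z zf].
    by rewrite !in_itv /= !ler0n /= divE -natr1 addrAC lerD2r.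
  rewrite in_itv /= => /andP[_ zle] j.
  exact: (balanced_coordinate_gt0 a a_gt0 B' x).
split=> [|i x _|x _]; [|exact: eq_atP|exact: eq_allP].
have [N1 hN1] := eventually_gt_fin R ('I_k * 'I_k)%type
  (fun p => (a p.1)%:R ^+ 2 * (C p.2)%:~R + (a p.1)%:R * B).
have [N2 hN2] := eventually_gt_fin R 'I_k
  (fun i => (a i)%:R^-1 * A%:R * (A%:R - (a i)%:R) * B').
exists (maxn N1 N2) => x _; rewrite geq_max => /andP[x1 x2]; split=> [i|].
  by apply: eq_atP => j _; exact: (hN1 x x1 (i, j)).
by apply: eq_allP => i; exact: hN2.
Qed.
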